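(* Let $\mathcal H$ be an infinite dimensional complex Hilbert space and let $m\geq 1$ be an integer. Every power bounded $m$-isometric operator $S\in B(\mathcal H)$ is isometric, i.e. $S^*S=I$.
   Context: $B(\mathcal H)$ denotes the algebra of bounded linear operators on $\mathcal H$. An operator $S\in B(\mathcal H)$ is power bounded if there is a scalar $M>0$ with $\sup_{n\in\mathbb N}\|S^n\|<M$. $S$ is $m$-isometric if $\sum_{j=0}^m(-1)^{m-j}\binom{m}{j}S^{*j}S^j=0$. *)

(* Defs.v *)
From HB Require Import structures.
From mathcomp Require Import all_boot all_order all_algebra.
From mathcomp Require Import all_classical all_reals all_analysis.
From mathcomp Require Import complex.

Set Implicit Arguments.
Unset Strict Implicit.
Unset Printing Implicit Defensive.

Import Order.TTheory GRing.Theory Num.Theory.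
Import numFieldNormedType.Exports.

Local Open Scope classical_set_scope.
Local Open Scope complex_scope.
Local Open Scope ring_scope.

(* A complex Hilbert space is a complete normed space H over R[i] together with
   a positive definite Hermitian form whose associated norm is the norm of H.
   The form is linear in its first argument, conjugate-linear in its second. *)
Definition inner_product (R : realType) (H : completeNormedModType R[i])
    (dot : {dot H for Num.conj}) : Prop :=
  forall x : H, `|x| ^+ 2 = dot x x.

Definition finite_dimensional (K : fieldType) (V : lmodType K) : Prop :=
  exists (n : nat) (e : 'I_n -> V),
    forall v : V, exists c : 'I_n -> K, v = \sum_(i < n) c i *: e i.

Section Operators.
Variables (R : realType) (H : completeNormedModType R[i]).

(* The norm of H takes its values in the nonnegative elements of R[i], hence the
   real part. The value is +oo when f is unbounded on the closed unit ball. *)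
Definition operator_norm (f : H -> H) : \bar R :=
  ereal_sup [set (complex.Re `|f x|)%:E | x in [set x : H | `|x| <= 1]].

Definition power_bounded (S : H -> H) : Prop :=
  exists2 M : R, 0 < M &
    (ereal_sup [set operator_norm (iter n S) | n in [set: nat]] < M%:E)%E.

Variable dot : {dot H for Num.conj}.

(* The Hilbert adjoint: S^* y is the vector z with <S x, y> = <x, z> for all x.
   Positive definiteness makes z unique, and for a bounded linear S it exists by
   the Riesz representation theorem, so that the default value is not used. *)
Definition adjoint (S : H -> H) : H -> H :=
  fun y => xget 0 [set z : H | forall x : H, dot (S x) y = dot x z].

(* The sum is taken in the vector space of maps H -> H. *)
Definition m_isometric (m : nat) (S : H -> H) : Prop :=
  \sum_(0 <= j < m.+1)
     ((-1) ^+ (m - j) * 'C(m, j)%:R : R[i])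
       *: (iter j (adjoint S) \o iter j S : H -> H) = 0.

Definition isometric (S : H -> H) : Prop := adjoint S \o S = id.

End Operators.

(* Main.v *)
Require Import Defs.
From HB Require Import structures.
From mathcomp Require Import all_boot all_order all_algebra.
From mathcomp Require Import all_classical all_reals all_analysis.
From mathcomp Require Import complex.
From mathcomp Require Import ring lra.

Set Implicit Arguments.
Unset Strict Implicit.
Unset Printing Implicit Defensive.

Import Order.TTheory GRing.Theory Num.Theory.
Import numFieldNormedType.Exports.

Local Open Scope classical_set_scope.
Local Open Scope complex_scope.
Local Open Scope ring_scope.

(** Fix [x] and put u_n = |S^n x|^2. Pairing the [m]-isometric identity at the
    point S^k x with that same point, and moving the adjoints to the other side
    of the inner product, says that the [m]-th finite difference of u vanishes
    at [k] ([m_isometric_fdiff]). Hence u is a polynomial in [n] of degree less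
    than [m]; power boundedness makes it bounded, so it is constant
    ([bounded_fdiff_eq0]). Comparing u_1 with u_0 shows that [S] preserves the
    norm, hence the inner product by polarization, and so S^* S x = x for every
    [x] ([rnorm_preserving_isometric]).

    Moving the adjoints requires that S^* really satisfies its defining
    relation, that is, that the functionals x |-> <S x, y> are represented by
    vectors. This is the Riesz representation theorem, obtained here by
    minimizing |x|^2 - 2 g(x) over the space ([riesz], [adjointP]).

    All estimates are carried out with the real inner product Re <x, y>
    ([rdot]) and the real-valued norm ([rnorm]), where the order is total. The
    real part loses nothing: it separates vectors, and Im <x, y> is
    recovered from it as Re <- i x, y>. *)

(** * Finite differences of bounded sequences *)

Section FiniteDifferences.
Variable R : realType.
Implicit Type u : nat -> R.

(** The [m]-th forward difference of [u] at [k], in the expanded form that the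
    [m]-isometric identity produces. *)
Definition fdiff m u k : R :=
  \sum_(j < m.+1) (-1) ^+ (m - j) * 'C(m, j)%:R * u (k + j)%N.

Lemma fdiff0 u k : fdiff 0 u k = u k.
Proof. by rewrite /fdiff big_ord1 mul1r mul1r addn0. Qed.

(** Pascal's rule, which splits each coefficient in two. *)
Lemma fdiffS m u k : fdiff m.+1 u k = fdiff m u k.+1 - fdiff m u k.
Proof.
rewrite {1}/fdiff big_ord_recl /= subn0 bin0 mulr1 addn0.
under eq_bigr => i _ do
  rewrite /bump /= add1n subSS binS natrD mulrDr mulrDl addnS -addSn.
rewrite big_split /= addrA addrC; congr (_ + _).
rewrite big_ord_recr /= bin_small // mulr0 mul0r addr0.
rewrite /fdiff big_ord_recl /= subn0 bin0 mulr1 addn0.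
rewrite opprD -sumrN exprS -mulrA mulN1r; congr (_ + _).
apply: eq_bigr => i _; rewrite /bump /= add1n.
by rewrite -(subnSK (ltn_ord i)) exprS !mulN1r !mulNr addSnnS.
Qed.

Lemma fdiffSr m u k : fdiff m.+1 u k = fdiff m (fun n => u n.+1 - u n) k.
Proof.
elim: m k => [|m IHm] k; first by rewrite fdiffS !fdiff0.
by rewrite fdiffS !IHm -fdiffS.
Qed.

(** A sequence with a vanishing difference of some order is polynomial, and a
    bounded polynomial is constant. The induction lowers the order by passing to
    the first difference v, which is bounded too: v is then constant, so u is
    affine, and boundedness forces its slope to be zero. *)
Lemma bounded_fdiff_eq0 m u (B : R) : (forall n, `|u n| <= B) ->
  (forall k, fdiff m.+1 u k = 0) -> forall n, u n.+1 = u n.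
Proof.
elim: m u B => [|m IHm] u B uB u0.
  by move=> n; apply/eqP; rewrite -subr_eq0 -(u0 n) fdiffS !fdiff0.
pose v n := u n.+1 - u n.
have vB n : `|v n| <= B + B by rewrite (le_trans (ler_normB _ _)) // lerD.
have vE : forall n, v n = v 0%N.
  elim=> // n <-; apply: (IHm v _ vB) => k.
  by rewrite -fdiffSr.
have uE n : u n = u 0%N + v 0%N *+ n.
  elim: n => [|n IHn]; first by rewrite addr0.
  by rewrite mulrSr addrA -IHn -(vE n) /v addrC subrK.
suff v0 : v 0%N = 0 by move=> n; apply/eqP; rewrite -subr_eq0 -/(v n) vE v0.
apply/eqP; rewrite -normr_le0 leNgt; apply/negP => v_gt0.
have BB0 : 0 <= (B + B) / `|v 0%N| by rewrite divr_ge0 // (le_trans _ (vB 0%N)).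
have := archi_boundP BB0; set n := Num.bound _.
rewrite ltr_pdivrMr // ltNge => /negP; apply.
have -> : n%:R * `|v 0%N| = `|u n - u 0%N|.
  by rewrite uE addrC addKr normrMn mulr_natl.
by rewrite (le_trans (ler_normB _ _)) // lerD.
Qed.
End FiniteDifferences.

(** * The real inner product of a complex Hilbert space *)

Section RealInnerProduct.
Variables (R : realType) (H : completeNormedModType R[i]).
Variable dot : {dot H for Num.conj}.
Hypothesis dotP : inner_product dot.

Definition rdot (x y : H) : R := complex.Re (dot x y).
Definition rnorm (x : H) : R := complex.Re `|x|.

Lemma rnormE x : `|x| = (rnorm x)%:C.
Proof. by rewrite /rnorm RRe_real // normr_real. Qed.

Lemma rnorm_ge0 x : 0 <= rnorm x.
Proof. by rewrite -ler0c -rnormE. Qed.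

Lemma rnorm0_eq0 x : rnorm x = 0 -> x = 0.
Proof. by move=> x0; apply/normr0_eq0; rewrite rnormE x0. Qed.

Lemma rnormZ (a : R) x : rnorm (a%:C *: x) = `|a| * rnorm x.
Proof.
apply: complexI; rewrite -rnormE normrZ rnormE normc_def /=.
by rewrite expr0n addr0 sqrtr_sqr rmorphM.
Qed.

Lemma rdotxx x : rdot x x = rnorm x ^+ 2.
Proof. by rewrite /rdot -dotP rnormE -rmorphXn. Qed.

Lemma rdotC x y : rdot x y = rdot y x.
Proof. by rewrite /rdot hermC mul1r /=; case: (dot y x). Qed.

Lemma rdotPl (a : R) x y w : rdot (a%:C *: x + y) w = a * rdot x w + rdot y w.
Proof.
rewrite /rdot linearPl /=; case: (dot x w) (dot y w) => [b c] [b' c'] /=.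
by rewrite mul0r subr0.
Qed.

Lemma rdotDl x y w : rdot (x + y) w = rdot x w + rdot y w.
Proof. by rewrite -{1}[x]scale1r rdotPl mul1r. Qed.

Lemma rdotZl (a : R) x w : rdot (a%:C *: x) w = a * rdot x w.
Proof.
by rewrite -{1}[_ *: x]addr0 rdotPl [rdot 0 w]/rdot linear0l /= addr0.
Qed.

Lemma rdotNl x w : rdot (- x) w = - rdot x w.
Proof. by rewrite -[x in LHS]scale1r -scaleNr -(rmorphN1 (real_complex R)) rdotZl mulN1r. Qed.

Lemma rdotDr x y w : rdot w (x + y) = rdot w x + rdot w y.
Proof. by rewrite rdotC rdotDl ![rdot w _]rdotC. Qed.

Lemma rdotZr (a : R) x w : rdot w (a%:C *: x) = a * rdot w x.
Proof. by rewrite rdotC rdotZl [rdot w _]rdotC. Qed.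

Lemma rdotNr x w : rdot w (- x) = - rdot w x.
Proof. by rewrite rdotC rdotNl [rdot w _]rdotC. Qed.

Definition rdotE := (rdotDl, rdotDr, rdotNl, rdotNr, rdotZl, rdotZr).

Lemma rdot_sumr I (r : seq I) (F : I -> H) w :
  rdot w (\sum_(i <- r) F i) = \sum_(i <- r) rdot w (F i).
Proof.
apply: (big_morph (rdot w)) => [x y|]; first exact: rdotDr.
by rewrite /rdot linear0r.
Qed.

(** The real part of the inner product is already positive definite. *)
Lemma rdotI x y : (forall w, rdot w x = rdot w y) -> x = y.
Proof.
move=> xy; apply/eqP; rewrite -subr_eq0; apply/eqP/rnorm0_eq0/eqP.
by rewrite -sqrf_eq0 -rdotxx rdotDr rdotNr xy subrr.
Qed.

(** Expand the square of the norm of |y| x - |x| y, which is nonnegative. *)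
Lemma cauchy_schwarz x y : rdot x y <= rnorm x * rnorm y.
Proof.
have [x0|x_neq0] := eqVneq (rnorm x) 0.
  by rewrite (rnorm0_eq0 x0) /rdot /rnorm linear0l normr0 mul0r.
have [y0|y_neq0] := eqVneq (rnorm y) 0.
  by rewrite (rnorm0_eq0 y0) /rdot /rnorm linear0r normr0 mulr0.
have xy_gt0 : 0 < rnorm x * rnorm y by rewrite mulr_gt0 // lt_def rnorm_ge0 andbT.
have := sqr_ge0 (rnorm ((rnorm y)%:C *: x - (rnorm x)%:C *: y)).
rewrite -rdotxx !rdotE !rdotxx [rdot y x]rdotC => le0.
rewrite -(ler_pM2l xy_gt0); lra.
Qed.

(** * Riesz representation and the adjoint *)

(** A representing vector is a minimum of J(x) = |x|^2 - 2 g(x), since the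
    derivative of J at z in the direction h is 2 (<h, z> - g(h)). The minimum is
    attained: by the parallelogram law, points where J is close to its infimum
    are close to each other, so the sublevel sets of J generate a Cauchy
    filter, and completeness provides its limit. *)
Lemma riesz (g : H -> R) (K : R) :
    (forall a x y, g (a%:C *: x + y) = a * g x + g y) ->
    (forall x, g x <= K * rnorm x) ->
  exists z, forall x, g x = rdot x z.
Proof.
move=> gP gK.
have g0 : g 0 = 0.
  by have := gP 1 0 0; rewrite scaler0 addr0 mul1r; lra.
have gZ a x : g (a%:C *: x) = a * g x by rewrite -[_ *: x]addr0 gP g0 addr0.
have gD x y : g (x + y) = g x + g y by rewrite -{1}[x]scale1r gP mul1r.
pose J x := rdot x x - 2 * g x.
have J_ge x : - K ^+ 2 <= J x.
  have := gK x; have := sqr_ge0 (rnorm x - K); rewrite /J rdotxx; lra.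
have J_inf : has_inf (range J).
  split; first by exists (J 0), 0.
  by exists (- K ^+ 2) => _ [x _ <-].
pose d := inf (range J).
have dJ x : d <= J x by apply: ge_inf; [case: J_inf | exists x].
have J_near e : 0 < e -> exists x, J x <= d + e.
  move=> e0; have [_ [x _ <-] /ltW xe] := inf_adherent e0 J_inf.
  by exists x.
(* The parallelogram law, with J at the midpoint bounded below by d. *)
have J_mid x y : rnorm (x - y) ^+ 2 <= 2 * (J x + J y - 2 * d).
  have := dJ ((2^-1)%:C *: (x + y)).
  rewrite -rdotxx /J gZ gD !rdotE [rdot y x]rdotC; lra.
pose F := filter_from [set e : R | 0 < e] (fun e => [set x | J x <= d + e]).
have F_filter : ProperFilter F.
  apply: filter_from_proper => [|e /= e0]; last exact: J_near.
  apply: filter_from_filter => [|e1 e2 /= e10 e20]; first by exists 1 => /=.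
  exists (Num.min e1 e2); first by rewrite /= lt_min e10.
  by move=> x /= xe; split; apply: (le_trans xe);
    rewrite lerD2l ge_min lexx ?orbT.
have F_cvg : cvg F.
  (* Radii are positive elements of R[i], hence real numbers. By J_mid, sublevel
     e^2 / 8 confines points to distance e / sqrt 2 of each other. *)
  apply/cauchy_cvgP/cauchy_exP => eps eps0.
  have epsE : eps = (complex.Re eps)%:C by rewrite RRe_real // gtr0_real.
  have e0 : 0 < complex.Re eps by rewrite -ltcR -epsE.
  move: (complex.Re eps) e0 epsE => e e0 -> {eps eps0}.
  have e8 : 0 < e ^+ 2 / 8 by rewrite divr_gt0 // exprn_gt0.
  have [x xe] := J_near _ e8.
  exists x, (e ^+ 2 / 8) => // y /= ye.
  rewrite -ball_normE /= rnormE ltcR.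
  rewrite -(ltr_sqr _ _) ?nnegrE ?rnorm_ge0 ?ltW //.
  have := J_mid x y; have := exprn_gt0 2 e0; lra.
pose z := lim F.
(* J is continuous, with a Lipschitz estimate near z that only involves z. *)
have Jz : J z <= d.
  apply/ler_addgt0Pr => e e0.
  pose c := 2 * (rnorm z + `|K|) + 1.
  have c0 : 0 < c by rewrite /c; have := rnorm_ge0 z; have := normr_ge0 K; lra.
  have r0 : 0 < e / 2 / c by rewrite divr_gt0 // divr_gt0.
  have Fball : F (ball z (e / 2 / c)%:C).
    by apply: F_cvg; apply: nbhsx_ballx; rewrite ltcR.
  have Fe : F [set x | J x <= d + e / 2] by exists (e / 2) => //=; lra.
  have [x [/=]] := filter_ex (filterI Fball Fe).
  rewrite -ball_normE /= rnormE ltcR ltr_pdivlMr // => zx xe.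
  have JE : J z - J x = 2 * rdot (z - x) z - rdot (z - x) (z - x) + 2 * g (x - z).
    rewrite /J gD -[- z]scaleN1r -(rmorphN1 (real_complex R)) gZ !rdotE.
    rewrite [rdot z x]rdotC; ring.
  have h1 := cauchy_schwarz (z - x) z.
  have h2 : g (x - z) <= rnorm (z - x) * `|K|.
    rewrite (le_trans (gK _)) // /rnorm distrC mulrC.
    by rewrite ler_wpM2l ?rnorm_ge0 ?ler_norm.
  have h3 : 0 <= rdot (z - x) (z - x) by rewrite rdotxx sqr_ge0.
  have h4 := rnorm_ge0 (z - x).
  move: zx; rewrite /c; lra.
exists z => h; apply/eqP; rewrite -subr_eq0; apply/eqP.
set b := _ - _; pose q := rdot h h.
have q0 : 0 <= q by rewrite /q rdotxx sqr_ge0.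
have tP t : 0 <= - (2 * t * b) + t ^+ 2 * q.
  have := le_trans Jz (dJ (t%:C *: h + z)).
  by rewrite /J /b /q gP !rdotE [rdot z h]rdotC; lra.
(* The quadratic in t is nonnegative with no constant term; t = b / (q + 1)
   stays meaningful when q = 0 and makes it negative unless b = 0. *)
have q1 : 0 < q + 1 by lra.
have := tP (b / (q + 1)).
have -> : - (2 * (b / (q + 1)) * b) + (b / (q + 1)) ^+ 2 * q
        = - ((b / (q + 1)) ^+ 2 * (q + 2)).
  by field; rewrite gt_eqF.
rewrite oppr_ge0 pmulr_lle0 => [sq_le0|]; last by lra.
have : b / (q + 1) == 0 by rewrite -sqrf_eq0 eq_le sq_le0 sqr_ge0.
by rewrite mulf_eq0 invr_eq0 (gt_eqF q1) orbF => /eqP.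
Qed.

(** The adjoint is defined by choice with a default value; the Riesz theorem
    rules the default out when [S] is bounded. *)
Lemma adjointP (S : {linear H -> H}) (K : R) :
    (forall x, rnorm (S x) <= K * rnorm x) ->
  forall x y, dot (S x) y = dot x (adjoint dot S y).
Proof.
move=> SK x y; rewrite /adjoint; move: x.
case: xgetP => [z _ //|] noz; exfalso.
have [||z zP] := @riesz (fun x => rdot (S x) y) (K * rnorm y).
- by move=> a x w; rewrite linearP rdotPl.
- move=> x; rewrite (le_trans (cauchy_schwarz _ _)) // mulrAC.
  by rewrite ler_wpM2r ?rnorm_ge0.
apply: (noz z) => x /=.
apply/eqP; rewrite eq_complex; apply/andP; split; first by apply/eqP/zP.
(* The imaginary parts agree because the real parts do at i x. *)
have := zP ('i%C *: x).
rewrite /rdot linearZ /= !linearZl_LR /= ![_ * dot _ _]mulrC !ReiNIm.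
by move=> /oppr_inj ->.
Qed.

(** * Power bounded and m-isometric operators *)

(** The operator norm only sees the closed unit ball; homogeneity extends its
    bound to all vectors. *)
Lemma power_bounded_rnorm (S : {linear H -> H}) : power_bounded S ->
  exists M : R, forall n x, rnorm (iter n S x) <= M * rnorm x.
Proof.
move=> [M _ S_lt]; exists M => n x.
have [x0|x_neq0] := eqVneq (rnorm x) 0.
  rewrite x0 mulr0 (rnorm0_eq0 x0).
  suff -> : iter n S 0 = 0 by rewrite /rnorm normr0.
  by elim: n => //= n ->; rewrite linear0.
have x_gt0 : 0 < rnorm x by rewrite lt_def x_neq0 rnorm_ge0.
have iterZ a w : iter n S (a *: w) = a *: iter n S w.
  by elim: n => //= n ->; rewrite linearZ.
rewrite -ler_pdivrMr // mulrC -(gtr0_norm x_gt0) -normfV -rnormZ -iterZ.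
rewrite -lee_fin (le_trans _ (ltW S_lt)) //.
apply: (@le_trans _ _ (operator_norm (iter n S))).
  apply: ereal_sup_ubound; exists ((rnorm x)^-1%:C *: x) => //=.
  rewrite rnormE rnormZ lecR gtr0_norm ?invr_gt0 // mulVf //.
by apply: ereal_sup_ubound; exists n.
Qed.

(** Pair the operator identity, evaluated at S^k x, with the vector S^k x: the
    term of index j is a multiple of <S^k x, S^{*j} S^j S^k x> = |S^(k+j) x|^2. *)
Lemma m_isometric_fdiff (m : nat) (S : {linear H -> H}) (K : R) :
    (forall x, rnorm (S x) <= K * rnorm x) -> m_isometric dot m S ->
  forall x k, fdiff m (fun n => rnorm (iter n S x) ^+ 2) k = 0.
Proof.
move=> SK mS x k; pose w := iter k S x.
have iter_adj j y v : dot (iter j S y) v = dot y (iter j (adjoint dot S) v).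
  elim: j v => //= j IHj v.
  by rewrite (adjointP SK) IHj -iterSr.
have := congr1 (fun f : H -> H => rdot w (f w)) mS.
rewrite fct_sumE /= rdot_sumr big_mkord [X in _ = X]/rdot linear0r => mSw.
apply: etrans mSw.
apply: eq_bigr => j _ /=.
have -> : ((-1) ^+ (m - j) * 'C(m, j)%:R : R[i])
   = ((-1) ^+ (m - j) * 'C(m, j)%:R)%:C.
  by rewrite rmorphM rmorphXn rmorphN1 rmorph_nat.
by rewrite rdotZr /rdot -iter_adj -/(rdot _ _) rdotxx -iterD addnC.
Qed.

(** By polarization <S w, S y> = <w, y> for all w, so that y itself has the
    property defining S^* (S y). *)
Lemma rnorm_preserving_isometric (S : {linear H -> H}) :
  (forall x, rnorm (S x) = rnorm x) -> isometric dot S.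
Proof.
move=> SE; have SK x : rnorm (S x) <= 1 * rnorm x by rewrite mul1r SE.
have polar x y : rdot (S x) (S y) = rdot x y.
  have : rdot (S (x + y)) (S (x + y)) = rdot (x + y) (x + y).
    by rewrite !rdotxx SE.
  rewrite linearD !rdotE !rdotxx !SE [rdot y x]rdotC [rdot (S y) _]rdotC; lra.
apply/funext => y; apply: rdotI => w /=.
by rewrite -(polar w y) /rdot (adjointP SK).
Qed.

End RealInnerProduct.

Theorem proposition2p6 (R : realType) (H : completeNormedModType R[i])
    (dot : {dot H for Num.conj}) (dotP : inner_product dot)
    (H_infinite : ~ finite_dimensional H)
    (m : nat) (m_gt0 : (0 < m)%N)
    (S : {linear H -> H}) (S_bounded : bounded_near S (nbhs (0 : H))) :
  power_bounded S -> m_isometric dot m S -> isometric dot S.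
Proof.
move=> /(power_bounded_rnorm)[M SM] mS.
apply: (rnorm_preserving_isometric dotP) => x.
have S1 := SM 1%N; have diff0 := m_isometric_fdiff dotP S1 mS x.
pose u n := rnorm (iter n S x) ^+ 2.
have uB n : `|u n| <= (M * rnorm x) ^+ 2.
  rewrite ger0_norm ?sqr_ge0 // lerXn2r ?nnegrE ?rnorm_ge0 //.
  exact: le_trans (rnorm_ge0 _) (SM n x).
rewrite -(prednK m_gt0) in diff0.
have := bounded_fdiff_eq0 uB diff0 0; rewrite /u /= => /eqP.
by rewrite eqrXn2 ?rnorm_ge0 // => /eqP.
Qed.
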